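(* Let $\mathcal{P}$ be a regular polyhedron in $\mathbb{E}^3$ such that $G(\mathcal{P})$ is either $[3,3]$ or $[3,4]$, and let $\mathbf{\Lambda}$ be a rank-$3$ lattice group on $\mathbb{E}^3$. If the quotient map $\pi_{\mathbf{\Lambda}}:\mathbb{E}^3\to\mathbb{T}^3_{\mathbf{\Lambda}}$ induces a symmetric toroidal realization of a regular polyhedron in $\mathbb{T}^3_{\mathbf{\Lambda}}$, then there exists $a>0$ such that $$a^{-1}\mathbf{\Lambda}\in\left\{\mathbf{\Lambda}_{(1,0,0)},\ \mathbf{\Lambda}_{(1,1,0)},\ \mathbf{\Lambda}_{(1,1,1)}\right\}.$$
   Context: Isometries act on the right. Polyhedra. A polyhedron $\mathcal{P}$ is a connected graph (its $1$-skeleton, parallel edges allowed) together with a family of subgraphs called faces such that every edge lies in at least one face, every face is a connected $2$-valent graph, and every vertex figure (the graph whose nodes are the edges at a given vertex, two being adjacent when they belong to a common face) is a connected $2$-valent graph; equivalently, a rank-$3$ abstract polytope. A flag is a mutually incident triple (vertex, edge, face). $\mathcal{P}$ is regular if its automorphism group $\Gamma(\mathcal{P})$ acts transitively on flags. Regular polyhedra in $\mathbb{E}^3$. A regular polyhedron in $\mathbb{E}^3$ is a regular polyhedron whose vertices are points of $\mathbb{E}^3$ forming a discrete set, whose edges are the line segments joining the two endpoints and whose faces are collections of such segments (distinct vertices, edges, faces of $\mathcal{P}$ giving distinct points, segments, collections), such that every automorphism is induced by an isometry of $\mathbb{E}^3$. $G(\mathcal{P})$ denotes its group of symmetries, generated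 by isometries $R_0,R_1,R_2$ inducing the distinguished automorphisms ($R_i$ sends the base flag to the flag differing from it exactly in the element of rank $i$). The groups $[3,3]$ and $[3,4]$ are taken in the following coordinates: $[3,3]$ is the symmetry group of the regular tetrahedron with vertices $(1,1,1),(-1,-1,1),(-1,1,-1),(1,-1,-1)$, generated by $(x,y,z)\mapsto(-y,-x,z)$, $(z,y,x)$, $(y,x,z)$; and $[3,4]$ is the symmetry group of the octahedron with vertices $\pm e_1,\pm e_2,\pm e_3$ (equivalently of the cube with vertices $(\pm1,\pm1,\pm1)$), generated by $(x,y,z)\mapsto(y,x,z)$, $(x,z,y)$, $(x,y,-z)$. (The regular polyhedra with these groups are the tetrahedron, octahedron, cube and their Petrie-duals.) Lattices and tori. A rank-$3$ lattice group $\mathbf{\Lambda}$ is a group of translations generated by three linearly independent translations; the associated lattice $\Lambda$ is the orbit of the origin. $a\mathbf{\Lambda}$ is the lattice group with lattice $a\Lambda$. $\mathbf{\Lambda}_{(1,0,0)},\mathbf{\Lambda}_{(1,1,0)},\mathbf{\Lambda}_{(1,1,1)}$ are the lattice groups whose lattices are, respectively, $\mathbb{Z}^3$; the integral vectors with even coordinate sum; the integral vectors whose three coordinates have the same parity. $\mathbb{T}^3_{\mathbf{\Lambda}}=\mathbb{E}^3/\mathbf{\Lambda}$ with the quotient metric, and $\pi_{\mathbf{\Lambda}}$ is the quotient map. An isometry $S$ of $\mathbb{E}^3$ induces an isometry $\overline{S}$ of $\mathbb{T}^3_{\mathbf{\Lambda}}$ if $\pi_{\mathbf{\Lambda}}(xS)=\pi_{\mathbf{\Lambda}}(x)\overline{S}$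 for all $x$. Toroidal realizations. A graph in $\mathbb{T}^3_{\mathbf{\Lambda}}$ is a set of points (vertices) with a set of geodesic arcs (edges), each having two distinct vertices as endpoints and no vertex in its interior. ''$\pi_{\mathbf{\Lambda}}$ induces a symmetric toroidal realization of a regular polyhedron $\mathcal{P}_{\mathbf{\Lambda}}$'' means: the images under $\pi_{\mathbf{\Lambda}}$ of the vertices and edges of $\mathcal{P}$ form a graph in $\mathbb{T}^3_{\mathbf{\Lambda}}$; this graph, together with the images of the faces of $\mathcal{P}$ as faces, is a regular polyhedron $\mathcal{P}_{\mathbf{\Lambda}}$; and the isometries $R_0,R_1,R_2$ of $\mathbb{E}^3$ generating $G(\mathcal{P})$ induce isometries of $\mathbb{T}^3_{\mathbf{\Lambda}}$, through which all automorphisms of $\mathcal{P}_{\mathbf{\Lambda}}$ are realized. *)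

(* Defs.v *)
From Stdlib Require Export Relation_Operators.
From HB Require Import structures.
From mathcomp Require Export all_boot all_order all_algebra.
From mathcomp Require Export all_classical all_reals.
From mathcomp Require Export topology normedtype.
Export Order.TTheory GRing.Theory Num.Theory.
Export numFieldNormedType.Exports.
Set Implicit Arguments.
Unset Strict Implicit.
Unset Printing Implicit Defensive.
Local Open Scope classical_set_scope.
Local Open Scope ring_scope.

(* Graphs may have parallel arcs but no loops. *)
Record multigraph (N A : Type) := MultiGraph {
  nodes : set N;
  arcs : set A;
  ends : A -> set N }.

Section Multigraph.
Variables (N A : Type).
Implicit Type G : multigraph N A.

Definition is_graph G := forall a, arcs G a ->
  exists x y, [/\ nodes G x, nodes G y, x <> y & ends G a = [set x; y]].

Definition adjacent G (x y : N) :=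
  exists2 a, arcs G a & ends G a = [set x; y].

Definition connected_graph G := nodes G !=set0 /\
  forall x y, nodes G x -> nodes G y -> clos_refl_trans N (adjacent G) x y.

Definition two_valent G := forall x, nodes G x ->
  exists a b, a <> b /\ [set c | arcs G c /\ ends G c x] = [set a; b].

End Multigraph.

(* A connected 2-valent subgraph has no isolated nodes, hence is determined by
   its arcs: a face is represented by the set of its edges. *)
Record prepolyhedron (N A : Type) := PrePolyhedron {
  skeleton :> multigraph N A;
  faces : set (set A) }.

Section Polyhedron.
Variables (N A : Type).
Implicit Type P : prepolyhedron N A.

Definition face_graph P (F : set A) : multigraph N A :=
  {| nodes := \bigcup_(e in F) ends P e; arcs := F; ends := ends P |}.

(* The edges at v are joined once for each face at v containing both, so that
   2-valency means that each edge at v lies in exactly two faces (the diamond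
   condition of abstract polytopes). *)
Definition vertex_figure P (v : N) : multigraph A (set A) :=
  {| nodes := [set e | arcs P e /\ ends P e v];
     arcs := [set F | faces P F /\ exists2 e, F e & ends P e v];
     ends := fun F => [set e | F e /\ ends P e v] |}.

Definition polyhedron P :=
  [/\ is_graph P /\ connected_graph P,
      forall e, arcs P e -> exists2 F, faces P F & F e,
      forall F, faces P F -> [/\ F `<=` arcs P,
        connected_graph (face_graph P F) & two_valent (face_graph P F)]
    & forall v, nodes P v -> [/\ is_graph (vertex_figure P v),
        connected_graph (vertex_figure P v) & two_valent (vertex_figure P v)]].

Definition is_flag P (v : N) (e : A) (F : set A) :=
  [/\ nodes P v, arcs P e, faces P F, ends P e v & F e].

Definition automorphism P (phi : N -> N) (psi : A -> A) :=
  [/\ set_bij (nodes P) (nodes P) phi,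
      set_bij (arcs P) (arcs P) psi,
      forall e, arcs P e -> ends P (psi e) = phi @` ends P e
    & [set psi @` F | F in faces P] = faces P].

Definition regular_polyhedron P := polyhedron P /\
  forall v e F v' e' F', is_flag P v e F -> is_flag P v' e' F' ->
  exists phi psi,
    [/\ automorphism P phi psi, phi v = v', psi e = e' & psi @` F = F'].

End Polyhedron.

Section Transformations.
Variable X : Type.

Definition transformation_group (H : set (X -> X)) :=
  [/\ H id,
      forall f g, H f -> H g -> H (f \o g)
    & forall f, H f -> exists2 g, H g & cancel f g /\ cancel g f].

Definition generated_group (B : set (X -> X)) : set (X -> X) :=
  smallest transformation_group B.

Definition isometry (R : Type) (d : X -> X -> R) (f : X -> X) :=
  bijective f /\ forall x y, d (f x) (f y) = d x y.

(* For polyhedra whose vertices are points and whose edges are point sets. *)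
Definition induced_by (P : prepolyhedron X (set X)) (phi : X -> X)
    (psi : set X -> set X) (S : X -> X) :=
  (forall v, nodes P v -> phi v = S v) /\
  (forall e, arcs P e -> psi e = S @` e).

End Transformations.

Section Euclidean.
Variable R : realType.

Local Notation E3 := 'rV[R]_3.

(* The library norm on row vectors is the sup norm. *)
Definition eucl_dist (x y : E3) : R :=
  Num.sqrt (\sum_i (x 0 i - y 0 i) ^+ 2).

Definition line_segment (x y : E3) : set E3 :=
  [set (1 - t) *: x + t *: y | t in [set t : R | 0 <= t <= 1]].

Definition eucl_regular_polyhedron (P : prepolyhedron E3 (set E3)) :=
  [/\ regular_polyhedron P,
      nodes P `<=` isolated (nodes P),
      forall e, arcs P e ->
        exists x y, ends P e = [set x; y] /\ e = line_segment x y
    & forall phi psi, automorphism P phi psi ->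
        exists2 S, isometry eucl_dist S & induced_by P phi psi S].

Definition symmetries (P : prepolyhedron E3 (set E3)) : set (E3 -> E3) :=
  [set S | isometry eucl_dist S /\ automorphism P S (image^~ S)].

(* R0, R1, R2 map the base flag (v, e, F) to the flag differing from it exactly
   in its vertex, edge, face respectively. *)
Definition distinguished_generators (P : prepolyhedron E3 (set E3))
    (R0 R1 R2 : E3 -> E3) :=
  symmetries P = generated_group [set R0; R1; R2] /\
  exists v e F, [/\ is_flag P v e F,
    [/\ R0 v <> v, R0 @` e = e & (image^~ R0) @` F = F],
    [/\ R1 v = v, R1 @` e <> e & (image^~ R1) @` F = F]
  & [/\ R2 v = v, R2 @` e = e & (image^~ R2) @` F <> F]].

Definition symmetry_group (A : set E3) : set (E3 -> E3) :=
  [set S | isometry eucl_dist S /\ S @` A = A].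

Definition point3 (x y z : R) : E3 := \row_(i < 3) [:: x; y; z]`_i.

Definition tetrahedral_group : set (E3 -> E3) := symmetry_group
  [set v | v \in [:: point3 1 1 1; point3 (-1) (-1) 1;
                     point3 (-1) 1 (-1); point3 1 (-1) (-1)]].

Definition octahedral_group : set (E3 -> E3) := symmetry_group
  [set v | v \in [:: point3 1 0 0; point3 (-1) 0 0; point3 0 1 0;
                     point3 0 (-1) 0; point3 0 0 1; point3 0 0 (-1)]].

Definition translation (v : E3) : E3 -> E3 := fun x => x + v.

Definition lattice_group (L : set (E3 -> E3)) :=
  exists2 B : 'M[R]_3, row_free B &
    L = generated_group [set translation (row i B) | i in [set: 'I_3]].

Definition lattice (L : set (E3 -> E3)) : set E3 := [set g 0 | g in L].

Definition translations (A : set E3) : set (E3 -> E3) :=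
  [set translation v | v in A].

Definition scale_group (a : R) (L : set (E3 -> E3)) : set (E3 -> E3) :=
  translations [set a *: v | v in lattice L].

Definition intvec (z : 'rV[int]_3) : E3 := map_mx intr z.

Definition Lambda100 : set (E3 -> E3) :=
  translations [set intvec z | z in [set: 'rV[int]_3]].

Definition Lambda110 : set (E3 -> E3) :=
  translations
    [set intvec z | z in [set z : 'rV[int]_3 | (2 %| (\sum_i z 0 i)%R)%Z]].

Definition Lambda111 : set (E3 -> E3) :=
  translations
    [set intvec z | z in
      [set z : 'rV[int]_3 | forall i j, (2 %| (z 0 i - z 0 j)%R)%Z]].

Definition orbit (L : set (E3 -> E3)) (x : E3) : set E3 := [set g x | g in L].

Definition torus (L : set (E3 -> E3)) : Type := set_type (range (orbit L)).

Definition torus_proj (L : set (E3 -> E3)) (x : E3) : torus L :=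
  exist _ (orbit L x) (mem_set (imageT (orbit L) x)).

Definition torus_dist (L : set (E3 -> E3)) (p q : torus L) : R :=
  inf [set eucl_dist x y | x in torus_proj L @^-1` [set p]
                         & y in torus_proj L @^-1` [set q]].

Definition induces (L : set (E3 -> E3)) (S : E3 -> E3)
    (T : torus L -> torus L) :=
  isometry (@torus_dist L) T /\
  forall x, torus_proj L (S x) = T (torus_proj L x).

Definition geodesic_arc (L : set (E3 -> E3)) (a : set (torus L))
    (p q : torus L) :=
  exists x y, [/\ torus_proj L x = p, torus_proj L y = q,
    a = torus_proj L @` line_segment x y
  & {in line_segment x y &, injective (torus_proj L)}].

Definition torus_graph (L : set (E3 -> E3))
    (G : multigraph (torus L) (set (torus L))) :=
  forall a, arcs G a -> exists p q,
    [/\ nodes G p /\ nodes G q, p <> q, ends G a = [set p; q],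
        geodesic_arc a p q & a `&` nodes G `<=` [set p; q]].

End Euclidean.

(* An image vertex and an image edge are incident when they are the images of
   an incident pair. *)
Definition image_polyhedron (X Y : Type) (f : X -> Y)
    (P : prepolyhedron X (set X)) : prepolyhedron Y (set Y) :=
  {| skeleton :=
       {| nodes := f @` nodes P;
          arcs := [set f @` e | e in arcs P];
          ends := fun a => \bigcup_(e in [set e | arcs P e /\ f @` e = a])
                             (f @` ends P e) |};
     faces := [set [set f @` e | e in F] | F in faces P] |}.

Definition symmetric_toroidal_realization (R : realType)
    (P : prepolyhedron 'rV[R]_3 (set 'rV[R]_3))
    (L : set ('rV[R]_3 -> 'rV[R]_3)) :=
  let PL := image_polyhedron (torus_proj L) P in
  [/\ torus_graph PL,
      regular_polyhedron PL
    & exists (R0 R1 R2 : 'rV[R]_3 -> 'rV[R]_3) (T0 T1 T2 : torus L -> torus L),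
      [/\ distinguished_generators P R0 R1 R2,
          [/\ induces R0 T0, induces R1 T1 & induces R2 T2]
        & forall phi psi, automorphism PL phi psi ->
            exists2 T, generated_group [set T0; T1; T2] T &
              induced_by PL phi psi T]].

(* Main.v *)
Require Import Defs.
From mathcomp Require Import ring zify.
Set Implicit Arguments.
Unset Strict Implicit.
Unset Printing Implicit Defensive.
Local Open Scope classical_set_scope.
Local Open Scope ring_scope.

(** The symmetries of P form a group generated by isometries that descend to
    the torus, so each of them maps points congruent modulo the lattice to
    congruent points ([induces_generated]). A symmetry fixing the origin
    therefore maps the lattice into itself. Both [3,3] and [3,4] contain
    the coordinate transpositions and the half-turn
    (x, y, z) |-> (x, -y, -z) ([tetra_octahedral_involutions]), and invariance
    under these alone determines the lattice up to scale ([cubic_lattice]).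

    Indeed, adding to a lattice vector its image by the half-turn leaves twice
    its first coordinate on the first axis. The lattice vectors on that axis
    form a discrete nonzero group, generated by some c > 0
    ([cyclic_real_subgroup]); permuting coordinates, twice any coordinate of
    any lattice vector is then a multiple of c. With b = c / 2, the lattice
    contains 2b Z^3, is contained in b Z^3, and does not contain (b, 0, 0). Such a
    lattice amounts to a subgroup of (Z/2)^3, stable under permutations, with
    no vector of weight one: it is 0, the even-weight vectors, or the span of
    (1, 1, 1) ([symmetric_subgroup_mod2]). These are the three cubic lattices,
    with a = c in the first case and a = b in the other two. *)

(** * Coordinates, and three involutions common to [3,3] and [3,4] *)

Section Coordinates.
Variable R : realType.
Local Notation E3 := 'rV[R]_3.

Lemma ord3_cases (i : 'I_3) : [\/ i = 0, i = 1 | i = 2].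
Proof.
by case: i => [[|[|[|//]]] lti];
  [apply: Or31 | apply: Or32 | apply: Or33]; apply: val_inj.
Qed.

Lemma row3P (T : Type) (v w : 'rV[T]_3) :
  v 0 0 = w 0 0 -> v 0 1 = w 0 1 -> v 0 2 = w 0 2 -> v = w.
Proof. by move=> e0 e1 e2; apply/rowP => i; case: (ord3_cases i) => ->. Qed.

Lemma sum_ord3 (V : nmodType) (F : 'I_3 -> V) : \sum_i F i = F 0 + F 1 + F 2.
Proof.
rewrite !big_ord_recl big_ord0 addr0 addrA.
by congr (F _ + F _ + F _); apply: val_inj.
Qed.

Lemma point3_0 (x y z : R) : point3 x y z 0 0 = x. Proof. by rewrite mxE. Qed.
Lemma point3_1 (x y z : R) : point3 x y z 0 1 = y. Proof. by rewrite mxE. Qed.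
Lemma point3_2 (x y z : R) : point3 x y z 0 2 = z. Proof. by rewrite mxE. Qed.
Definition point3E := (point3_0, point3_1, point3_2).

Definition swap01 (v : E3) : E3 := point3 (v 0 1) (v 0 0) (v 0 2).
Definition swap12 (v : E3) : E3 := point3 (v 0 0) (v 0 2) (v 0 1).
Definition half_turn (v : E3) : E3 := point3 (v 0 0) (- v 0 1) (- v 0 2).

Lemma symmetry_group_involution (A : set E3) (S : E3 -> E3) :
    involutive S ->
    (forall x y, eucl_dist (S x) (S y) = eucl_dist x y) ->
    (forall x, A x -> A (S x)) ->
  symmetry_group A S.
Proof.
move=> SK Sd SA; split; first by split=> //; exists S.
apply/seteqP; split=> [_ [x Ax <-]|x Ax]; first exact: SA.
by exists (S x); [exact: SA | rewrite SK].
Qed.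

Lemma swap01K : involutive swap01.
Proof. by move=> v; apply: row3P; rewrite !point3E. Qed.

Lemma swap12K : involutive swap12.
Proof. by move=> v; apply: row3P; rewrite !point3E. Qed.

Lemma half_turnK : involutive half_turn.
Proof. by move=> v; apply: row3P; rewrite !point3E ?opprK. Qed.

Lemma swap01_dist x y : eucl_dist (swap01 x) (swap01 y) = eucl_dist x y.
Proof. by rewrite /eucl_dist !sum_ord3 !point3E; congr Num.sqrt; ring. Qed.

Lemma swap12_dist x y : eucl_dist (swap12 x) (swap12 y) = eucl_dist x y.
Proof. by rewrite /eucl_dist !sum_ord3 !point3E; congr Num.sqrt; ring. Qed.

Lemma half_turn_dist x y :
  eucl_dist (half_turn x) (half_turn y) = eucl_dist x y.
Proof. by rewrite /eucl_dist !sum_ord3 !point3E; congr Num.sqrt; ring. Qed.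

Lemma swap01_point x y z : swap01 (point3 x y z) = point3 y x z.
Proof. by rewrite /swap01 !point3E. Qed.

Lemma swap12_point x y z : swap12 (point3 x y z) = point3 x z y.
Proof. by rewrite /swap12 !point3E. Qed.

Lemma half_turn_point x y z :
  half_turn (point3 x y z) = point3 x (- y) (- z).
Proof. by rewrite /half_turn !point3E. Qed.

Lemma tetra_octahedral_involutions (G : set (E3 -> E3)) :
    G = @tetrahedral_group R \/ G = @octahedral_group R ->
  [/\ G swap01, G swap12 & G half_turn].
Proof.
have imE := (@swap01_point, @swap12_point, @half_turn_point,
  @opprK R, @oppr0 R).
case=> ->; split; apply: symmetry_group_involution => [|x y|v /=];
  rewrite ?swap01_dist ?swap12_dist ?half_turn_dist //;
  try by [exact: swap01K | exact: swap12K | exact: half_turnK].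
all: rewrite !inE.
all: by repeat (first [case/orP]); move=> /eqP ->; rewrite !imE eqxx ?orbT.
Qed.

End Coordinates.

(** * Lattice groups and the congruence they define *)

Section LatticeGroup.
Variable R : realType.
Local Notation E3 := 'rV[R]_3.
Implicit Type L : set (E3 -> E3).

Definition translation_vectors L : set E3 := [set v | L (translation v)].

Definition subgroup (V : zmodType) (A : set V) :=
  A 0 /\ forall x y, A x -> A y -> A (x - y).

Lemma subgroupN (V : zmodType) (A : set V) x : subgroup A -> A x -> A (- x).
Proof. by move=> [A0 AB] Ax; rewrite -sub0r; apply: AB. Qed.

Lemma subgroupD (V : zmodType) (A : set V) x y :
  subgroup A -> A x -> A y -> A (x + y).
Proof.
by move=> gA Ax Ay; rewrite -[y]opprK; apply: gA.2 => //; apply: subgroupN.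
Qed.

Lemma subgroupMz (V : zmodType) (A : set V) x (k : int) :
  subgroup A -> A x -> A (x *~ k).
Proof.
move=> gA Ax; elim: k => [|n IH|n IH]; first by rewrite mulr0z; exact: gA.1.
- by rewrite intS mulrzDr mulr1z; apply: subgroupD.
- by rewrite intS opprD mulrzDr mulrN1z addrC; apply: gA.2.
Qed.

Lemma translation0 : translation (0 : E3) = id.
Proof. by apply/funext => x; rewrite /translation addr0. Qed.

Lemma intvecB (y z : 'rV[int]_3) : intvec R (y - z) = intvec R y - intvec R z.
Proof. exact: map_mxB. Qed.

Lemma integral_translations_group (B : 'M[R]_3) :
  transformation_group [set translation (intvec R z *m B) | z in setT].
Proof.
split.
- by exists 0 => //; rewrite /intvec map_mx0 mul0mx translation0.
- move=> _ _ [y _ <-] [z _ <-]; exists (z + y) => //.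
  apply/funext => x; rewrite /translation /=.
  by rewrite /intvec map_mxD mulmxDl addrA.
- move=> _ [z _ <-]; exists (translation (intvec R (- z) *m B)).
    by exists (- z).
  by split=> x; rewrite /translation /intvec map_mxN mulNmx ?addrK ?subrK.
Qed.

(** The integral translations form a group containing the generators, hence
    contain L by minimality. The subgroup property is checked inside each
    group containing the generators, where the inverse of a translation must
    be the opposite translation. *)
Lemma lattice_groupP L : lattice_group L -> exists B : 'M[R]_3,
  [/\ B \in unitmx,
      forall g, L g -> exists z, g = translation (intvec R z *m B),
      forall i, translation_vectors L (row i B)
    & subgroup (translation_vectors L)].
Proof.
case=> B freeB defL; exists B.
have span g : L g -> exists z, g = translation (intvec R z *m B).
  move=> Lg; suff [z _ <-] : [set translation (intvec R z *m B) | z in setT] g.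
    by exists z.
  rewrite defL in Lg; apply: Lg; split.
    exact: integral_translations_group.
  move=> _ [i _ <-]; exists (delta_mx 0 i) => //.
  by rewrite rowE /intvec map_delta_mx.
split=> //; first by rewrite -row_free_unit.
- by move=> i; rewrite /translation_vectors /= defL => H [_]; apply; exists i.
split.
  by rewrite /translation_vectors /= translation0 defL => H [[]].
move=> u v; rewrite /translation_vectors /= defL => Lu Lv H sH.
have [[_ HM HV] _] := sH.
have [h Hh [_ hK]] := HV _ (Lv _ sH).
suff -> : translation (u - v) = translation u \o h by exact: HM (Lu _ sH) Hh.
apply/funext => x /=; rewrite -{1}[x]hK /translation.
by rewrite addrCA addrK addrC.
Qed.

Lemma latticeE L : lattice_group L -> lattice L = translation_vectors L.
Proof.
move=> /lattice_groupP[B [_ span _ _]]; apply/seteqP; split=> v.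
- move=> [g Lg <-]; have [z eg] := span g Lg.
  rewrite /translation_vectors /= eg /translation add0r.
  by rewrite -/(translation _) -eg.
- by move=> Lv; exists (translation v); rewrite // /translation add0r.
Qed.

Lemma torus_proj_eq L x y : lattice_group L ->
  torus_proj L x = torus_proj L y <-> translation_vectors L (x - y).
Proof.
move=> /lattice_groupP[B [_ span _ gL]].
have sub u v : translation_vectors L (u - v) -> orbit L u `<=` orbit L v.
  move=> Luv _ [g Lg <-]; have [z eg] := span g Lg.
  exists (translation (intvec R z *m B + (u - v))).
    by apply: (subgroupD gL) Luv; rewrite /translation_vectors /= -eg.
  by rewrite eg /translation addrCA [v + _]addrC subrK addrC.
split=> [exy|Lxy].
- have : orbit L x x.
    by exists id => //; rewrite -translation0; exact: gL.1.
  have -> : orbit L x = orbit L y by case: exy.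
  move=> [g Lg <-]; have [z eg] := span g Lg.
  by rewrite eg /translation addrAC subrr add0r /translation_vectors /= -eg.
- apply: eq_exist; apply/seteqP; split; apply: sub => //.
  by rewrite -opprB; exact: subgroupN.
Qed.

(** Inverses of such maps must also respect congruence, hence the equivalence
    rather than an implication: its converse half, for a generator, is the
    injectivity of the induced isometry of the torus. *)
Lemma induces_generated L (B : set (E3 -> E3)) :
    (forall S, B S -> bijective S /\ exists T, induces (L := L) S T) ->
  forall S, generated_group B S ->
  forall x y, torus_proj L x = torus_proj L y <->
              torus_proj L (S x) = torus_proj L (S y).
Proof.
move=> indB S genS.
suff [] : [set f : E3 -> E3 | bijective f /\ forall x y,
  torus_proj L x = torus_proj L y <->
  torus_proj L (f x) = torus_proj L (f y)] S by [].
apply: genS; split=> [|f /indB[bijf [T [[bijT _] indT]]]]; last first.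
  split=> // x y; rewrite !indT.
  by split=> [->//|]; exact: (bij_inj bijT).
split=> [|f g [bf Hf] [bg Hg]|f [[g fK gK] Hf]].
- by split=> //; exists id.
- split=> [|x y]; first exact: bij_comp.
  by rewrite Hg Hf.
- exists g; split=> //; first by exists f.
  by move=> x y; rewrite (Hf (g x)) !gK.
Qed.

End LatticeGroup.

(** * Classification of the invariant lattices *)

Section CubicLattices.
Variable R : realType.
Local Notation E3 := 'rV[R]_3.

Lemma cyclic_int_subgroup (I : set int) : subgroup I ->
    (exists2 k, I k & k != 0) ->
  exists n : nat, [/\ (0 < n)%N, I n & forall k, I k -> (n %| k)%Z].
Proof.
move=> gI [k0 Ik0 k0_neq0].
have exI : exists n : nat, (0 < n)%N && `[< I n%:Z >].
  exists `|k0|%N; rewrite absz_gt0 k0_neq0; apply/asboolP.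
  by case: (intP k0) Ik0 => // n /(subgroupN gI); rewrite ?opprK.
have [n /andP[n_gt0 /asboolP In] n_min] := ex_minnP exI.
exists n; split=> // k Ik; apply/dvdz_mod0P.
have Ir : I (k %% n)%Z.
  rewrite /modz; apply: gI.2 => //.
  by rewrite mulrC -[_ * _]mulrzz; exact: subgroupMz.
have r_ge0 : (0 <= k %% n)%Z by rewrite modz_ge0 // gt_eqF.
have r_lt : (k %% n < n)%Z by rewrite ltz_pmod.
move: Ir r_ge0 r_lt; case: (k %% n)%Z => // r Ir _ rn.
case: (posnP r) => [->//|r_gt0].
have := n_min r; rewrite r_gt0 /= => /(_ (asboolT Ir)).
by rewrite leqNgt -ltz_nat rn.
Qed.

(** Discreteness enters as the existence of one scale b at which all the
    elements of A are integers, which reduces the claim to subgroups of the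
    integers. *)
Lemma cyclic_real_subgroup (A : set R) (b : R) : subgroup A ->
    (forall t, A t -> exists k : int, t * b = k%:~R) ->
    (exists2 t, A t & t != 0) -> b != 0 ->
  exists c : R, [/\ 0 < c, A c & forall t, A t -> exists k : int, t = c *~ k].
Proof.
move=> gA intA [t At t_neq0] b_neq0.
have gI : subgroup [set k : int | A (k%:~R / b)].
  split=> [|k l] /=; first by rewrite mul0r; exact: gA.1.
  by move=> Ak Al; rewrite rmorphB mulrBl; exact: gA.2.
have [|n [n_gt0 An dvdA]] := cyclic_int_subgroup gI.
  have [k tk] := intA _ At; exists k; first by rewrite /= -tk mulfK.
  by rewrite -(intr_eq0 R) -tk mulf_neq0.
have c_neq0 : n%:R / b != 0 by rewrite mulf_neq0 ?invr_neq0 // pnatr_eq0 -lt0n.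
exists `|n%:R / b|; rewrite normr_gt0; split=> //.
  by case: ger0P => _; [exact: An | exact: subgroupN gA An].
move=> s As; have [k sk] := intA _ As.
have /dvdzP[q kq] : (n %| k)%Z by apply: dvdA; rewrite /= -sk mulfK.
have sE : s = (n%:R / b) *~ q.
  by rewrite -[s](mulfK b_neq0) sk kq rmorphM /= -[RHS]mulrzl mulrA.
by case: ger0P => _; [exists q | exists (- q); rewrite mulrNz mulNrz opprK].
Qed.

Definition ivec3 (x y z : int) : 'rV[int]_3 := \row_(i < 3) [:: x; y; z]`_i.

Lemma ivec3_0 x y z : ivec3 x y z 0 0 = x. Proof. by rewrite mxE. Qed.
Lemma ivec3_1 x y z : ivec3 x y z 0 1 = y. Proof. by rewrite mxE. Qed.
Lemma ivec3_2 x y z : ivec3 x y z 0 2 = z. Proof. by rewrite mxE. Qed.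
Definition ivec3E := (ivec3_0, ivec3_1, ivec3_2).

Lemma ivec3_eta (z : 'rV[int]_3) : z = ivec3 (z 0 0) (z 0 1) (z 0 2).
Proof. by apply: row3P; rewrite ivec3E. Qed.

Lemma ivec3B x y z x' y' z' :
  ivec3 x y z - ivec3 x' y' z' = ivec3 (x - x') (y - y') (z - z').
Proof. by apply: row3P; rewrite ivec3E !mxE. Qed.

(** As M contains all doubled vectors, membership only depends on the parities
    of the coordinates: M amounts to a permutation-invariant subgroup of
    (Z/2)^3; vectors of weight one being
    excluded, those of weights two and three cannot both occur, as they differ
    by one of weight one. *)
Lemma symmetric_subgroup_mod2 (M : set 'rV[int]_3) : subgroup M ->
    (forall x y z, M (ivec3 x y z) -> M (ivec3 y x z)) ->
    (forall x y z, M (ivec3 x y z) -> M (ivec3 x z y)) ->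
    (forall z, M (z *+ 2)) -> ~ M (ivec3 1 0 0) ->
  [\/ M = [set z *+ 2 | z in [set: 'rV[int]_3]],
      M = [set z | (2 %| (\sum_i z 0 i)%R)%Z]
    | M = [set z | forall i j, (2 %| (z 0 i - z 0 j)%R)%Z]].
Proof.
move=> gM M01 M12 M2 nM100.
pose bit (x : int) : bool := ~~ (2 %| x)%Z.
pose q (x : int) : int := (x %/ 2)%Z.
pose m (a b c : bool) := M (ivec3 a b c).
have Mbit z : M z <-> m (bit (z 0 0)) (bit (z 0 1)) (bit (z 0 2)).
  rewrite /m; set w := ivec3 _ _ _.
  have [d zw] : exists d, z - w = d *+ 2.
    have half (x : int) : (x - (bit x)%:Z = q x *+ 2).
      by rewrite [RHS]mulr2n /bit /q; lia.
    exists (ivec3 (q (z 0 0)) (q (z 0 1)) (q (z 0 2))).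
    rewrite {1}[z]ivec3_eta ivec3B !half.
    by apply: row3P; rewrite mulmxnE !ivec3E.
  split=> [Mz|Mw].
    have -> : w = z - d *+ 2 by rewrite -zw subKr.
    exact: gM.2.
  have -> : z = w + d *+ 2 by rewrite -zw subrKC.
  exact: subgroupD.
have m000 : m false false false.
  rewrite /m (_ : ivec3 _ _ _ = 0); first exact: gM.1.
  by apply: row3P; rewrite ivec3E mxE.
have m100 : ~ m true false false by [].
have m010 : ~ m false true false by move=> /M01.
have m001 : ~ m false false true by move=> /M12 /M01.
have sumE (z : 'rV[int]_3) :
    (2 %| (\sum_i z 0 i)%R)%Z =
      ~~ (bit (z 0 0) (+) bit (z 0 1) (+) bit (z 0 2)).
  by rewrite sum_ord3 /bit; lia.
have [m110|n110] := pselect (m true true false).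
  have m101 : m true false true by exact: M12.
  have m011 : m false true true by exact: M01.
  (* (1, 1, 1) - (1, 1, 0) has weight one. *)
  have m111 : ~ m true true true.
    by move=> /(gM.2 _ _) /(_ m110); rewrite ivec3B.
  apply: Or32; apply/seteqP; split=> z /=; rewrite Mbit sumE;
    by case: (bit _); case: (bit _); case: (bit _).
have n101 : ~ m true false true by move=> /M12.
have n011 : ~ m false true true by move=> /M01 /M12.
have [m111|n111] := pselect (m true true true).
  apply: Or33; apply/seteqP; split=> z /=; rewrite Mbit.
    move=> mz; suff [e1 e2] :
        bit (z 0 0) = bit (z 0 1) /\ bit (z 0 0) = bit (z 0 2).
      move=> i j; move: e1 e2; rewrite /bit.
      by case: (ord3_cases i) => ->; case: (ord3_cases j) => ->; lia.
    by move: mz; case: (bit _); case: (bit _); case: (bit _).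
  move=> par; have := par 0 1; have := par 0 2 => p02 p01.
  have -> : bit (z 0 1) = bit (z 0 0) by rewrite /bit; lia.
  have -> : bit (z 0 2) = bit (z 0 0) by rewrite /bit; lia.
  by case: (bit _).
apply: Or31; apply/seteqP; split=> z /=; last by case=> w _ <-.
rewrite Mbit => mz.
have [e0 e1 e2] :
    [/\ bit (z 0 0) = false, bit (z 0 1) = false & bit (z 0 2) = false].
  by move: mz; case: (bit _); case: (bit _); case: (bit _).
exists (ivec3 (q (z 0 0)) (q (z 0 1)) (q (z 0 2))) => //.
by move: e0 e1 e2; rewrite /bit => e0 e1 e2; apply: row3P;
  rewrite mulmxnE [LHS]mulr2n ivec3E /q; lia.
Qed.

Lemma scale_groupE (L : set (E3 -> E3)) (a : R) (Z : set 'rV[int]_3) :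
    lattice_group L -> a != 0 ->
    translation_vectors L = [set a *: intvec R z | z in Z] ->
  scale_group a^-1 L = translations [set intvec R z | z in Z].
Proof.
move=> hL a_neq0 LE; rewrite /scale_group latticeE // LE; congr translations.
rewrite image_comp; apply: eq_imagel => z _ /=.
by rewrite scalerA mulVf ?scale1r.
Qed.

(** The simple, face-centred and body-centred cubic lattices are the only
    lattices with this invariance. *)
Lemma cubic_lattice (L : set (E3 -> E3)) : lattice_group L ->
    (forall v, translation_vectors L v -> translation_vectors L (swap01 v)) ->
    (forall v, translation_vectors L v -> translation_vectors L (swap12 v)) ->
    (forall v, translation_vectors L v ->
       translation_vectors L (half_turn v)) ->
  exists2 a : R, 0 < a &
    [\/ scale_group a^-1 L = @Lambda100 R,
        scale_group a^-1 L = @Lambda110 R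
      | scale_group a^-1 L = @Lambda111 R].
Proof.
move=> hL; have [B [unitB span rows gL]] := lattice_groupP hL.
set V := translation_vectors L in rows gL * => V01 V12 Vh.
pose A := [set t | V (point3 t 0 0)].
have gA : subgroup A.
  split=> [|s t As At]; rewrite /A /=.
    have -> : point3 0 0 0 = 0 :> E3 by apply: row3P; rewrite point3E mxE.
    exact: gL.1.
  have -> : point3 (s - t) 0 0 = point3 s 0 0 - point3 t 0 0 :> E3.
    by apply: row3P; rewrite !(point3E, mxE) ?subr0.
  exact: gL.2.
have A2 v : V v -> A (v 0 0 *+ 2).
  move=> Vv; rewrite /A /=.
  have -> : point3 (v 0 0 *+ 2) 0 0 = v + half_turn v :> E3.
    by apply: row3P; rewrite [RHS]mxE !point3E ?subrr ?mulr2n.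
  by apply: subgroupD => //; exact: Vh.
have A2i v i : V v -> A (v 0 i *+ 2).
  move=> Vv; case: (ord3_cases i) => ->; first exact: A2.
    by have := A2 _ (V01 _ Vv); rewrite point3E.
  by have := A2 _ (V01 _ (V12 _ Vv)); rewrite !point3E.
(* On the first axis, the j-th coordinate in the lattice basis is
   proportional to the abscissa, by a nonzero factor for a suitable j. *)
have [j Bj] : exists j, invmx B 0 j != 0.
  apply: contrapT => /forallNP Bj.
  have : (invmx B *m B) 0 0 = 0.
    rewrite mxE big1 // => j _.
    by move/negP/negPn/eqP: (Bj j) => ->; rewrite mul0r.
  by rewrite mulVmx // mxE => /eqP; rewrite oner_eq0.
have intA t : A t -> exists k : int, t * invmx B 0 j = k%:~R.
  move=> /span[z ez]; exists (z 0 j).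
  have tz : point3 t 0 0 = intvec R z *m B.
    by have := congr1 (fun g => g 0) ez; rewrite /translation !add0r.
  have := congr1 (fun v => (v *m invmx B) 0 j) tz.
  by rewrite mulmxK // !mxE sum_ord3 !point3E !mul0r !addr0.
have [i Bi] : exists i, B 0 i != 0.
  apply: contrapT => /forallNP Bi.
  have : (B *m invmx B) 0 0 = 0.
    rewrite mxE big1 // => k _.
    by move/negP/negPn/eqP: (Bi k) => ->; rewrite mul0r.
  by rewrite mulmxV // mxE => /eqP; rewrite oner_eq0.
have A_neq0 : exists2 t, A t & t != 0.
  exists (B 0 i *+ 2); first by have := A2i _ i (rows 0); rewrite mxE.
  by rewrite mulrn_eq0.
have [c [c_gt0 Ac Ac_gen]] := cyclic_real_subgroup gA intA A_neq0 Bj.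
pose b := c / 2; have b2 : b *+ 2 = c by rewrite -mulr_natr divfK ?pnatr_eq0.
have b_gt0 : 0 < b by rewrite divr_gt0.
pose M := [set z | V (b *: intvec R z)].
have VE : V = [set b *: intvec R z | z in M].
  apply/seteqP; split=> v => [Vv|[z Mz <-]//].
  have half k : exists m : int, v 0 k = b *~ m.
    have [m em] := Ac_gen _ (A2i _ k Vv); exists m.
    apply: (mulIf (_ : 2 != 0 :> R)); rewrite ?pnatr_eq0 // !mulr_natr em -b2.
    by rewrite !pmulrn -!mulrzA mulrC.
  have [[m0 e0] [m1 e1] [m2 e2]] := And3 (half 0) (half 1) (half 2).
  have vE : v = b *: intvec R (ivec3 m0 m1 m2).
    by apply: row3P; rewrite mxE mxE ivec3E ?(e0, e1, e2) mulrzr.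
  by exists (ivec3 m0 m1 m2); rewrite // /M /= -vE.
have bpoint x y z :
    b *: intvec R (ivec3 x y z) = point3 (b *~ x) (b *~ y) (b *~ z).
  by apply: row3P; rewrite mxE mxE ivec3E point3E mulrzr.
have axis (k : int) : V (point3 (c *~ k) 0 0) by exact: (subgroupMz k gA Ac).
have : [\/ M = [set z *+ 2 | z in [set: 'rV[int]_3]],
      M = [set z | (2 %| (\sum_i z 0 i)%R)%Z]
    | M = [set z | forall i j, (2 %| (z 0 i - z 0 j)%R)%Z]].
  apply: symmetric_subgroup_mod2 => [|x y z|x y z|z|].
  - split=> [|y z My Mz]; rewrite /M /=.
      by rewrite /intvec map_mx0 scaler0; exact: gL.1.
    by rewrite intvecB scalerBr; exact: gL.2.
  - by rewrite /M /= !bpoint => /V01; rewrite swap01_point.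
  - by rewrite /M /= !bpoint => /V12; rewrite swap12_point.
  - rewrite /M /=.
    have -> : b *: intvec R (z *+ 2) = point3 (c *~ z 0 0) 0 0
        + swap01 (point3 (c *~ z 0 1) 0 0)
        + swap12 (swap01 (point3 (c *~ z 0 2) 0 0)).
      rewrite !swap01_point swap12_point -b2.
      by apply: row3P; rewrite !(point3E, mulmxnE, mxE); ring.
    apply: (subgroupD gL); first apply: (subgroupD gL) => //.
      exact: V01.
    by apply: V12; apply: V01.
  (* b = c / 2 is not a multiple of c. *)
  - rewrite /M /= bpoint mulr0z => /Ac_gen[k ek].
    have : 1%:~R = (2 * k)%:~R :> R.
      by apply: (mulfI (lt0r_neq0 b_gt0)); rewrite mulrzr ek -b2; ring.
    by move/intr_inj; lia.
case=> ME; [exists c | exists b | exists b] => //.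
- apply: Or31; apply: scale_groupE (lt0r_neq0 c_gt0) _ => //.
  rewrite -/V VE ME image_comp; apply: eq_imagel => z _ /=.
  by rewrite /intvec raddfMn -scalerMnr scalerMnl b2.
- by apply: Or32; apply: scale_groupE (lt0r_neq0 b_gt0) _ => //; rewrite -ME.
- by apply: Or33; apply: scale_groupE (lt0r_neq0 b_gt0) _ => //; rewrite -ME.
Qed.

End CubicLattices.

Theorem theorem4p10 (R : realType)
    (P : prepolyhedron 'rV[R]_3 (set 'rV[R]_3))
    (L : set ('rV[R]_3 -> 'rV[R]_3))
    (hP : eucl_regular_polyhedron P)
    (hG : symmetries P = @tetrahedral_group R \/
          symmetries P = @octahedral_group R)
    (hL : lattice_group L)
    (hreal : symmetric_toroidal_realization P L) :
  exists2 a : R, 0 < a &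
    [\/ scale_group a^-1 L = @Lambda100 R,
        scale_group a^-1 L = @Lambda110 R
      | scale_group a^-1 L = @Lambda111 R].
Proof.
have [G01 G12 Gh] := tetra_octahedral_involutions hG.
case: hreal => _ _ [R0 [R1 [R2 [T0 [T1 [T2 [[genP _] [ind0 ind1 ind2] _]]]]]]].
have indR S : [set R0; R1; R2] S ->
    bijective S /\ exists T, induces (L := L) S T.
  move=> RS; split.
    have : symmetries P S by rewrite genP => H [_]; apply.
    by case=> [[]].
  by case: RS => [[->|->]|->]; [exists T0 | exists T1 | exists T2].
have inv S : symmetries P S -> S 0 = 0 ->
    forall v, translation_vectors L v -> translation_vectors L (S v).
  move=> GS S0 v; rewrite -{1}[v]subr0 -(torus_proj_eq _ _ hL).
  rewrite (induces_generated indR); last by rewrite -genP; exact: GS.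
  by rewrite S0 torus_proj_eq // subr0.
have point0 : point3 0 0 0 = 0 :> 'rV[R]_3 by apply: row3P; rewrite !mxE.
apply: cubic_lattice => //; apply: inv => //;
  by rewrite -point0 (swap01_point, swap12_point, half_turn_point) ?oppr0.
Qed.
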